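(* Let $f\colon A\to B$ be a flat homomorphism of commutative rings with unit and let $I$ be an ideal of $A$. Then $f(S_I)\subseteq S_{f(I)B}$. Moreover, if $f$ is faithfully flat, then for every $a\in A$ we have that $a\in S_I$ if and only if $f(a)\in S_{f(I)B}$.
   Context: For a commutative ring $R$ and an ideal $L$ of $R$, the regular-denominator set of $L$ is $S_L:=\{r\in R\mid \text{multiplication by } r \text{ on } R/L \text{ is injective}\}=\{r\in R\mid (L:r)=L\}$. Thus $S_I\subseteq A$ and $S_{f(I)B}\subseteq B$, where $f(I)B$ is the ideal of $B$ generated by $f(I)$. *)

(* Defs.v *)
From HB Require Import structures.
From mathcomp Require Import all_boot all_algebra.
From mathcomp Require Import boolp classical_sets.
From mathcomp Require Import freeg.

Set Implicit Arguments.
Unset Strict Implicit.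
Unset Printing Implicit Defensive.

Import GRing.Theory.

Local Open Scope classical_set_scope.
Local Open Scope ring_scope.
Local Open Scope quotient_scope.

(* Rings are [comPzRingType]s, so the zero ring is allowed. Ideals are Prop-valued
   sets and may be the whole ring, unlike MathComp's [idealr]. *)

Definition is_ideal (R : comPzRingType) (L : set R) : Prop :=
  [/\ L 0, (forall x y, L x -> L y -> L (x + y))
    & (forall r x, L x -> L (r * x))].

Record ideal (R : comPzRingType) := Ideal {
  ideal_set :> set R;
  ideal_subproof : is_ideal ideal_set
}.

Section IdealTheory.
Variables (R : comPzRingType) (L : ideal R).

Lemma ideal0 : ideal_set L 0. Proof. by case: (ideal_subproof L). Qed.

Lemma idealD x y : ideal_set L x -> ideal_set L y -> ideal_set L (x + y).
Proof. by case: (ideal_subproof L) => _ + _; apply. Qed.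

Lemma idealM r x : ideal_set L x -> ideal_set L (r * x).
Proof. by case: (ideal_subproof L) => _ _; apply. Qed.

Lemma idealB x y : ideal_set L x -> ideal_set L y -> ideal_set L (x - y).
Proof. by move=> Lx Ly; apply: idealD => //; rewrite -mulN1r; apply: idealM. Qed.

End IdealTheory.

Section IdealQuotient.
Variables (R : comPzRingType) (L : ideal R).

Definition ideal_mem : {pred R} := fun x => `[< ideal_set L x >].

Lemma ideal_memP x : reflect (ideal_set L x) (x \in ideal_mem).
Proof. exact: asboolP. Qed.

Lemma ideal_mem_zmod_closed : zmod_closed ideal_mem.
Proof.
split=> [|x y /ideal_memP Lx /ideal_memP Ly]; apply/ideal_memP.
  exact: ideal0.
exact: idealB.
Qed.

HB.instance Definition _ := GRing.isZmodClosed.Build R ideal_mem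
  ideal_mem_zmod_closed.

Definition ideal_quotient := Quotient.quot ideal_mem.

HB.instance Definition _ := GRing.Zmodule.on ideal_quotient.

Definition ideal_proj (x : R) : ideal_quotient := \pi_(Quotient.quot ideal_mem) x.

Lemma ideal_projP x y : ideal_proj x = ideal_proj y <-> ideal_set L (x - y).
Proof.
split=> [/eqP|Lxy]; last apply/eqP.
  by rewrite -[_ == _]Quotient.idealrBE => /ideal_memP.
by rewrite -[_ == _]Quotient.idealrBE; apply/ideal_memP.
Qed.

Lemma ideal_proj_surj q : exists x, ideal_proj x = q.
Proof. by exists (repr (q : Quotient.quot ideal_mem)); rewrite /ideal_proj reprK. Qed.

Definition quotient_mul (r : R) (q : ideal_quotient) : ideal_quotient :=
  ideal_proj (r * repr (q : Quotient.quot ideal_mem)).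

Lemma quotient_mulE r x : quotient_mul r (ideal_proj x) = ideal_proj (r * x).
Proof.
apply/ideal_projP; rewrite -mulrBr; apply: idealM; apply/ideal_projP.
exact: reprK.
Qed.

End IdealQuotient.

Definition ideal_colon (R : comPzRingType) (L : set R) (r : R) : set R :=
  [set x | L (x * r)].

Definition regular_denominators (R : comPzRingType) (L : ideal R) : set R :=
  [set r | injective (@quotient_mul R L r)].

Lemma regular_denominatorsE (R : comPzRingType) (L : ideal R) :
  regular_denominators L = [set r | ideal_colon L r = L].
Proof.
apply/seteqP; split=> r /= => [inj_r|colon_r x y].
  apply/seteqP; split=> x Lx; last by rewrite /ideal_colon /= mulrC; apply: idealM.
  rewrite -[x]subr0; apply/ideal_projP/inj_r; rewrite !quotient_mulE.
  by apply/ideal_projP; rewrite mulr0 subr0 mulrC.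
have [[a <-] [b <-]] := (ideal_proj_surj x, ideal_proj_surj y).
rewrite !quotient_mulE => /ideal_projP Lab; apply/ideal_projP.
by rewrite -colon_r /ideal_colon /= mulrC mulrBr.
Qed.

Section ExtendedIdeal.
Variables (A B : comPzRingType) (f : {rmorphism A -> B}) (I : ideal A).

Definition extended_set : set B := smallest (@is_ideal B) (f @` I).

Lemma extended_set_is_ideal : is_ideal extended_set.
Proof.
split=> [J [[]//]|x y Ex Ey J HJ|r x Ex J HJ].
  by case: (HJ) => [[_ + _] _]; apply; [apply: Ex | apply: Ey].
by case: (HJ) => [[_ _ +] _]; apply; apply: Ex.
Qed.

Definition extended_ideal : ideal B := Ideal extended_set_is_ideal.

End ExtendedIdeal.

Definition is_subgroup (V : zmodType) (H : set V) : Prop :=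
  H 0 /\ forall x y, H x -> H y -> H (x - y).

Section Tensor.
Variables (A : comPzRingType) (M N : lmodType A).

Definition tensor_relators : set {freeg (M * N)} :=
  [set x | (exists m m' n, x = << (m + m', n) >> - << (m, n) >> - << (m', n) >>)
        \/ (exists m n n', x = << (m, n + n') >> - << (m, n) >> - << (m, n') >>)
        \/ (exists a m n, x = << (a *: m, n) >> - << (m, a *: n) >>)].

Definition tensor_kernel : set {freeg (M * N)} :=
  smallest (@is_subgroup {freeg (M * N)}) tensor_relators.

Definition tensor_kernel_mem : {pred {freeg (M * N)}} :=
  fun x => `[< tensor_kernel x >].

Lemma tensor_kernel_memP x : reflect (tensor_kernel x) (x \in tensor_kernel_mem).
Proof. exact: asboolP. Qed.

Lemma tensor_kernel_zmod_closed : zmod_closed tensor_kernel_mem.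
Proof.
split=> [|x y /tensor_kernel_memP Kx /tensor_kernel_memP Ky].
  by apply/tensor_kernel_memP => H [[]].
apply/tensor_kernel_memP => H HH; case: (HH) => [[_ +] _].
by apply; [apply: Kx | apply: Ky].
Qed.

HB.instance Definition _ := GRing.isZmodClosed.Build {freeg (M * N)}
  tensor_kernel_mem tensor_kernel_zmod_closed.

(* Only the underlying abelian group of the tensor product of M and N over A:
   its A-module structure plays no role in the exactness of sequences. *)
Definition tensor := Quotient.quot tensor_kernel_mem.

HB.instance Definition _ := GRing.Zmodule.on tensor.

Definition tensor_proj (x : {freeg (M * N)}) : tensor :=
  \pi_(Quotient.quot tensor_kernel_mem) x.

Definition tens (m : M) (n : N) : tensor := tensor_proj << (m, n) >>.

Lemma tensor_projP x y :
  tensor_proj x = tensor_proj y <-> tensor_kernel (x - y).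
Proof.
split=> [/eqP|Kxy]; last apply/eqP.
  by rewrite -[_ == _]Quotient.idealrBE => /tensor_kernel_memP.
by rewrite -[_ == _]Quotient.idealrBE; apply/tensor_kernel_memP.
Qed.

Lemma tensor_proj_surj t : exists x, tensor_proj x = t.
Proof.
by exists (repr (t : Quotient.quot tensor_kernel_mem)); rewrite /tensor_proj reprK.
Qed.

Lemma tensor_projB : zmod_morphism tensor_proj.
Proof. by move=> x y; rewrite /tensor_proj raddfB. Qed.

HB.instance Definition _ :=
  GRing.isZmodMorphism.Build {freeg (M * N)} tensor tensor_proj tensor_projB.

Lemma tensDl m m' n : tens (m + m') n = tens m n + tens m' n.
Proof.
rewrite /tens -raddfD; apply/tensor_projP => H [_]; apply.
by left; exists m, m', n; rewrite opprD addrA.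
Qed.

Lemma tensDr m n n' : tens m (n + n') = tens m n + tens m n'.
Proof.
rewrite /tens -raddfD; apply/tensor_projP => H [_]; apply.
by right; left; exists m, n, n'; rewrite opprD addrA.
Qed.

Lemma tensZ a m n : tens (a *: m) n = tens m (a *: n).
Proof. by apply/tensor_projP => H [_]; apply; right; right; exists a, m, n. Qed.

(* Universal property: balanced biadditive maps factor through the tensor product. *)
Lemma tensor_lift (V : zmodType) (phi : M -> N -> V) :
    (forall m m' n, phi (m + m') n = phi m n + phi m' n) ->
    (forall m n n', phi m (n + n') = phi m n + phi m n') ->
    (forall a m n, phi (a *: m) n = phi m (a *: n)) ->
  exists g : {additive tensor -> V}, forall m n, g (tens m n) = phi m n.
Proof.
move=> phiDl phiDr phiZ.
pose h : {freeg (M * N)} -> zmodule V := fglift (fun p : M * N => phi p.1 p.2 : zmodule V).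
have hB : zmod_morphism h by move=> x y; rewrite /h lift_is_additive.
have hU m n : h << (m, n) >> = phi m n by rewrite /h liftU scale1r.
have h0 : h 0 = 0 by have := hB 0 0; rewrite !subrr.
have hK x : tensor_kernel x -> h x = 0.
  move=> Kx; apply: (Kx [set z | h z = 0]).
  split=> [|y [|[]] [a [b [c ->]]]] /=.
  - by split=> // y y' /= hy hy'; rewrite hB hy hy' subrr.
  - by rewrite !hB !hU phiDl -addrA -opprD subrr.
  - by rewrite !hB !hU phiDr -addrA -opprD subrr.
  - by rewrite hB !hU phiZ subrr.
pose g (t : tensor) : V := h (repr (t : Quotient.quot tensor_kernel_mem)).
have gE x : g (tensor_proj x) = h x.
  apply/eqP; rewrite -subr_eq0 -[_ - _]hB hK //.
  by apply/tensor_projP; exact: reprK.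
have gB : zmod_morphism g.
  move=> t t'; have [x <-] := tensor_proj_surj t.
  have [x' <-] := tensor_proj_surj t'.
  by rewrite -raddfB !gE hB.
exists (HB.pack_for {additive tensor -> V} g
  (GRing.isZmodMorphism.Build tensor V g gB)) => m n /=.
by rewrite gE hU.
Qed.

End Tensor.

Section TensorMap.
Variables (A : comPzRingType) (N M M' : lmodType A) (u : {linear M -> M'}).

Definition free_map (x : {freeg (M * N)}) : {freeg (M' * N)} :=
  fglift (fun p : M * N => << (u p.1, p.2) >> : {freeg (M' * N)}) x.

Lemma free_mapB : zmod_morphism free_map.
Proof. by move=> x y; rewrite /free_map lift_is_additive. Qed.

HB.instance Definition _ := GRing.isZmodMorphism.Build
  {freeg (M * N)} {freeg (M' * N)} free_map free_mapB.

Lemma free_mapU m n : free_map << (m, n) >> = << (u m, n) >>.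
Proof. by rewrite /free_map liftU scale1r. Qed.

Lemma free_map_kernel x : tensor_kernel x -> tensor_kernel (free_map x).
Proof.
move=> Kx H [[H0 HB] HR]; apply: (Kx [set z | H (free_map z)]).
split=> [|z [|[]] [a [b [c ->]]]].
- by split=> [|y z Hy Hz] /=; [rewrite raddf0 | rewrite raddfB; apply: HB].
- rewrite /= 2!raddfB /= !free_mapU linearD; apply: HR.
  by left; exists (u a), (u b), c.
- rewrite /= 2!raddfB /= !free_mapU; apply: HR.
  by right; left; exists (u a), b, c.
- rewrite /= raddfB /= !free_mapU linearZ; apply: HR.
  by right; right; exists a, (u b), c.
Qed.

Definition tensor_map (t : tensor M N) : tensor M' N :=
  tensor_proj (free_map (repr (t : Quotient.quot (@tensor_kernel_mem A M N)))).

Lemma tensor_map_proj x : tensor_map (tensor_proj x) = tensor_proj (free_map x).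
Proof.
apply/tensor_projP; rewrite -raddfB; apply: free_map_kernel.
by apply/tensor_projP; exact: reprK.
Qed.

Lemma tensor_map_tens m n : tensor_map (tens m n) = tens (u m) n.
Proof. by rewrite /tens tensor_map_proj free_mapU. Qed.

Lemma tensor_mapB : zmod_morphism tensor_map.
Proof.
move=> t t'; have [x <-] := tensor_proj_surj t.
have [x' <-] := tensor_proj_surj t'.
by rewrite -raddfB !tensor_map_proj !raddfB.
Qed.

HB.instance Definition _ :=
  GRing.isZmodMorphism.Build (tensor M N) (tensor M' N) tensor_map tensor_mapB.

End TensorMap.

Arguments tensor_map {A} N {M M'} u t.

Definition exact_at (U V W : zmodType) (u : U -> V) (v : V -> W) : Prop :=
  range u = [set y | v y = 0].

Definition flat (A : comPzRingType) (N : lmodType A) : Prop :=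
  forall (M1 M2 M3 : lmodType A) (u : {linear M1 -> M2}) (v : {linear M2 -> M3}),
    exact_at u v -> exact_at (tensor_map N u) (tensor_map N v).

Definition faithfully_flat (A : comPzRingType) (N : lmodType A) : Prop :=
  forall (M1 M2 M3 : lmodType A) (u : {linear M1 -> M2}) (v : {linear M2 -> M3}),
    exact_at u v <-> exact_at (tensor_map N u) (tensor_map N v).

Definition restrict_scalars (A B : comPzRingType) (f : {rmorphism A -> B}) : Type :=
  B.

Section RestrictScalars.
Variables (A B : comPzRingType) (f : {rmorphism A -> B}).
Local Notation restrict_scalars := (restrict_scalars f).

HB.instance Definition _ := GRing.Zmodule.on restrict_scalars.

Definition restrict_scale (a : A) (b : restrict_scalars) : restrict_scalars :=
  f a * (b : B).

Lemma restrict_scaleA a b x :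
  restrict_scale a (restrict_scale b x) = restrict_scale (a * b) x.
Proof. by rewrite /restrict_scale rmorphM mulrA. Qed.

Lemma restrict_scale1 : left_id 1 restrict_scale.
Proof. by move=> x; rewrite /restrict_scale rmorph1 mul1r. Qed.

Lemma restrict_scaleDr : right_distributive restrict_scale +%R.
Proof. by move=> a x y; rewrite /restrict_scale mulrDr. Qed.

Lemma restrict_scaleDl x : {morph restrict_scale^~ x : a b / a + b}.
Proof. by move=> a b; rewrite /restrict_scale rmorphD mulrDl. Qed.

HB.instance Definition _ := GRing.Zmodule_isLmodule.Build A restrict_scalars
  restrict_scaleA restrict_scale1 restrict_scaleDr restrict_scaleDl.

End RestrictScalars.

Definition flat_hom (A B : comPzRingType) (f : {rmorphism A -> B}) : Prop :=
  flat (restrict_scalars f).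

Definition faithfully_flat_hom (A B : comPzRingType) (f : {rmorphism A -> B}) :
  Prop := faithfully_flat (restrict_scalars f).

(* Main.v *)
(** Multiplication by [a] on [A/I] is injective iff the sequence
    [A/I -0-> A/I -a-> A/I] is exact. Every element of [A/I ⊗ B] has the form
    [1 ⊗ b], and [1 ⊗ b = 0] iff [b] lies in [f(I)B]; hence the sequence tensored
    with [B] is exact iff multiplication by [f a] on [B/f(I)B] is injective. *)
Require Import Defs.
From HB Require Import structures.
From mathcomp Require Import all_boot all_algebra.
From mathcomp Require Import boolp classical_sets.
From mathcomp Require Import freeg.
Import GRing.Theory.
Local Open Scope classical_set_scope.
Local Open Scope ring_scope.

Lemma tens0l (A : comPzRingType) (M N : lmodType A) (n : N) :
  tens (0 : M) n = 0.
Proof. by apply: (addrI (tens 0 n)); rewrite -tensDl !addr0. Qed.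

Lemma tens0r (A : comPzRingType) (M N : lmodType A) (m : M) :
  tens m (0 : N) = 0.
Proof. by apply: (addrI (tens m 0)); rewrite -tensDr !addr0. Qed.

(** Every element of the free abelian group is a finite integer combination of generators, and a
    subgroup is closed under such combinations. *)
Lemma tensor_ind (A : comPzRingType) (M N : lmodType A) (H : set (tensor M N)) :
  is_subgroup H -> (forall m n, H (tens m n)) -> forall t, H t.
Proof.
case=> H0 HB Hgen t; have [x <-] := tensor_proj_surj t.
have HN s : H s -> H (- s) by rewrite -sub0r => Hs; apply: HB.
have HD s s' : H s -> H s' -> H (s + s').
  by move=> Hs /HN Hs'; rewrite -[s']opprK; apply: HB.
have HMn s k : H s -> H (s *+ k).
  by move=> Hs; elim: k => [|k IHk]; rewrite ?mulr0n ?mulrS //; apply: HD.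
rewrite -[x]freeg_sumE raddf_sum; apply: (big_ind H) => // -[m n] _.
(* Each summand becomes an integer multiple of a pure tensor; the sign of the integer then separates
   a natural multiple from the opposite of one. *)
rewrite -[coeff _ _]intz -freegU_mulz raddfMz /=.
by case: (coeff _ _) => k; [apply: HMn | apply/HN/HMn]; apply: Hgen.
Qed.

(** The image of [u] is zero, so exactness says that the kernel of [v] is trivial. Only pointwise
    vanishing of [u] is asked, so that a tensored zero map also qualifies. *)
Lemma exact_at_zeroP (U V W : zmodType) (u : U -> V) (v : {additive V -> W}) :
  (forall x, u x = 0) -> (exact_at u v <-> injective v).
Proof.
move=> u0; split=> [uv x y vxy|v_inj].
  have : range u (x - y) by rewrite uv /= raddfB vxy subrr.
  by case=> z _; rewrite u0 => /esym/subr0_eq.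
apply/seteqP; split=> [_ [z _ <-]|y /= vy0]; first by rewrite /= u0 raddf0.
by exists 0 => //; rewrite u0; apply: v_inj; rewrite vy0 raddf0.
Qed.

Section QuotientModule.
Variables (R : comPzRingType) (L : ideal R).

Lemma quotient_mulA a b (q : ideal_quotient L) :
  quotient_mul a (quotient_mul b q) = quotient_mul (a * b) q.
Proof. by have [x <-] := ideal_proj_surj q; rewrite !quotient_mulE mulrA. Qed.

Lemma quotient_mul1 : left_id 1 (@quotient_mul R L).
Proof.
by move=> q; have [x <-] := ideal_proj_surj q; rewrite quotient_mulE mul1r.
Qed.

Lemma ideal_projB : zmod_morphism (@ideal_proj R L).
Proof. by move=> x y; rewrite /ideal_proj raddfB. Qed.

HB.instance Definition _ := GRing.isZmodMorphism.Build
  R (ideal_quotient L) (@ideal_proj R L) ideal_projB.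

Lemma quotient_mulDr : right_distributive (@quotient_mul R L) +%R.
Proof.
move=> a q q'; have [[x <-] [y <-]] := (ideal_proj_surj q, ideal_proj_surj q').
by rewrite -raddfD !quotient_mulE mulrDr raddfD.
Qed.

Lemma quotient_mulDl (q : ideal_quotient L) :
  {morph (@quotient_mul R L)^~ q : a b / a + b}.
Proof.
move=> a b; have [x <-] := ideal_proj_surj q.
by rewrite !quotient_mulE mulrDl raddfD.
Qed.

HB.instance Definition _ := GRing.Zmodule_isLmodule.Build R (ideal_quotient L)
  quotient_mulA quotient_mul1 quotient_mulDr quotient_mulDl.

Lemma ideal_projZ a x : ideal_proj L (a * x) = a *: ideal_proj L x.
Proof. exact/esym/quotient_mulE. Qed.

(** Commutativity of [R] makes multiplication by [a] linear, hence an arrow to which [flat]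
    applies. *)
Lemma quotient_mul_linear a : linear (@quotient_mul R L a).
Proof.
move=> b q q'; have mulE c p : quotient_mul c p = c *: p by [].
by rewrite !mulE scalerDr !scalerA mulrC.
Qed.

HB.instance Definition _ a := GRing.isLinear.Build R (ideal_quotient L)
  (ideal_quotient L) *:%R (@quotient_mul R L a) (quotient_mul_linear a).

Lemma ideal_proj_eq0 x : ideal_proj L x = 0 <-> ideal_set L x.
Proof. by rewrite -(raddf0 (@ideal_proj R L)) ideal_projP subr0. Qed.

End QuotientModule.

Section BaseChange.
Variables (A B : comPzRingType) (f : {rmorphism A -> B}) (I : ideal A).
Local Notation AI := (ideal_quotient I).
Local Notation fB := (restrict_scalars f).

Lemma extended_ideal_sub x :
  ideal_set I x -> ideal_set (extended_ideal f I) (f x).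
Proof. by move=> Ix J [_]; apply; exists x. Qed.

Lemma tens_ideal_proj a (b : fB) :
  tens (ideal_proj I a) b = tens (ideal_proj I 1) (f a * b : fB).
Proof. by rewrite -[a in LHS]mulr1 ideal_projZ tensZ. Qed.

(** The tensors [1 ⊗ b] form a subgroup, and it contains every pure tensor because scalars move
    across to [B]. *)
Lemma tensor_quotient_surj (t : tensor AI fB) :
  exists b : fB, t = tens (ideal_proj I 1) b.
Proof.
have tensB (b c : fB) : tens (ideal_proj I 1) (b - c) =
    tens (ideal_proj I 1) b - tens (ideal_proj I 1) c.
  by apply/eqP; rewrite eq_sym subr_eq -tensDr subrK.
move: t; apply: tensor_ind => [|q b]; last first.
  have [x <-] := ideal_proj_surj q.
  by exists (f x * b : fB); exact: tens_ideal_proj.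
split=> [|_ _ [b ->] [c ->]]; last by exists (b - c); rewrite tensB.
by exists 0; rewrite tens0r.
Qed.

(** This is the injectivity half of the isomorphism between [A/I ⊗ B] and [B/f(I)B], together with
    its well-definedness. *)
Lemma tens1_eq0 (b : fB) :
  tens (ideal_proj I 1) b = 0 <-> ideal_set (extended_ideal f I) b.
Proof.
split=> [tb0|Eb].
  (* The balanced map sending the class of [x] and [c] to the class of [c * f x]; [phiE] shows
     independence of the representative, since [f] maps [I] into [f(I)B]. *)
  pose phi (q : AI) (c : fB) := quotient_mul (c : B)
    (ideal_proj (extended_ideal f I)
       (f (repr (q : Quotient.quot (ideal_mem I))))).
  have phiE x c : phi (ideal_proj I x) c =
      ideal_proj (extended_ideal f I) (c * f x).
    rewrite /phi quotient_mulE; apply/ideal_projP; rewrite -mulrBr -rmorphB.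
    apply: idealM; apply: extended_ideal_sub; apply/ideal_projP.
    exact: reprK.
  have [|||g gE] := @tensor_lift A AI fB _ phi.
  - move=> q q' c.
    have [[x <-] [y <-]] := (ideal_proj_surj q, ideal_proj_surj q').
    by rewrite -raddfD !phiE rmorphD mulrDr raddfD.
  - by move=> q c d; rewrite /phi quotient_mulDl.
  - move=> a q c; have [x <-] := ideal_proj_surj q.
    by rewrite -ideal_projZ !phiE rmorphM mulrCA mulrA.
  (* The induced map [g] sends [1 ⊗ b] to the class of [b], so that class vanishes with the
     tensor. *)
  apply/ideal_proj_eq0; rewrite -[b]mulr1 -[1](rmorph1 f) -phiE -gE tb0.
  exact: raddf0.
(* The factor [1] will serve as the value of [d]. *)
rewrite -[b](mul1r (b : B)).
(* Quantifying over [d] makes the annihilator of [1 ⊗ _] visibly an ideal. *)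
apply: (Eb [set c | forall d : B, tens (ideal_proj I 1) (d * c : fB) = 0]).
split=> [|_ [x Ix <-] d] /=.
  split=> [d|c c' Kc Kc' d|r c Kc d] /=; first by rewrite mulr0 tens0r.
    by rewrite mulrDr tensDr Kc Kc' addr0.
  by rewrite mulrA Kc.
by rewrite mulrC -tens_ideal_proj (iffRL (ideal_proj_eq0 _ _ _) Ix) tens0l.
Qed.

Lemma tensor_map_mul_inj a :
  injective (tensor_map fB (@quotient_mul A I a)) <->
  regular_denominators (extended_ideal f I) (f a).
Proof.
have mapE (b : fB) : tensor_map fB (@quotient_mul A I a)
    (tens (ideal_proj I 1) b) = tens (ideal_proj I 1) (f a * b : fB).
  by rewrite tensor_map_tens /= quotient_mulE mulr1; exact: tens_ideal_proj.
(* Both maps are additive, so it suffices to treat differences in their kernels, where [tens1_eq0]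
   translates between [1 ⊗ b] and the class of [b]. *)
split=> [map_inj q q' eq_qq'|mul_inj t t' eq_tt']; apply/subr0_eq.
  have : quotient_mul (f a) (q - q') = 0 by rewrite raddfB /= eq_qq' subrr.
  have [b <-] := ideal_proj_surj (q - q').
  rewrite quotient_mulE => /ideal_proj_eq0/tens1_eq0; rewrite -mapE => mapb0.
  apply/ideal_proj_eq0/tens1_eq0/map_inj; by rewrite mapb0 raddf0.
have : tensor_map fB (@quotient_mul A I a) (t - t') = 0.
  by rewrite raddfB /= eq_tt' subrr.
have [b ->] := @tensor_quotient_surj (t - t').
rewrite mapE => /tens1_eq0/ideal_proj_eq0 fab0.
apply/tens1_eq0/ideal_proj_eq0/mul_inj.
by rewrite quotient_mulE fab0 raddf0.
Qed.

Lemma tensor_exact_mulP a :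
  exact_at (tensor_map fB (\0 : {linear AI -> AI}))
           (tensor_map fB (@quotient_mul A I a)) <->
  regular_denominators (extended_ideal f I) (f a).
Proof.
rewrite -tensor_map_mul_inj; apply: exact_at_zeroP => t.
have [b ->] := @tensor_quotient_surj t; rewrite tensor_map_tens.
exact: tens0l.
Qed.

End BaseChange.

Theorem proposition4p1 (A B : comPzRingType) (f : {rmorphism A -> B})
    (I : ideal A) (f_flat : flat_hom f) :
  f @` regular_denominators I `<=` regular_denominators (extended_ideal f I) /\
  (faithfully_flat_hom f ->
   forall a : A,
     regular_denominators I a <->
     regular_denominators (extended_ideal f I) (f a)).
Proof.
have exactP a : exact_at (\0 : {linear ideal_quotient I -> ideal_quotient I})
    (@quotient_mul A I a) <-> regular_denominators I a.
  exact: exact_at_zeroP.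
(* Flatness transports exactness to the tensored sequence; faithful flatness also reflects it, which
   gives the converse. *)
split=> [_ [a /exactP/f_flat/tensor_exact_mulP Sa <-] //|f_ff a].
by rewrite -exactP -tensor_exact_mulP; apply: f_ff.
Qed.
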